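(* For each $n\ge1$ let $W=W(n)$ be the unique positive root of $We^W=n$, $d_n=\lfloor W\rfloor$, $\lambda_j=W^j/j!$ ($j\ge1$), $R_n=\lambda_{d_n}=W^{d_n}/d_n!$, let $\{V_j\}_{j\ge1}$ be independent with $V_j$ Poisson of parameter $\lambda_j$ (under a probability measure $\mathbb{P}$), and let $\bar V_n=\max_{j\ge1}V_j$. Let $\Phi$ denote the standard normal distribution function. Then for any $c\in\mathbb{R}$, as $n\to\infty$, $$\left|\mathbb{P}\left(\bar V_n\le R_n-c\sqrt{R_n}\right)-\prod_{j\in\{d_n-1,d_n,d_n+1\}}\mathbb{P}\left(V_j\le R_n-c\sqrt{R_n}\right)\right|=o\left(e^{-n/\log^6 n}\right),$$ and $$\prod_{j=d_n-1}^{d_n+1}\mathbb{P}\left(V_j\le R_n-c\sqrt{R_n}\right)=\Phi(-c)\prod_{j\in\{d_n-1,d_n+1\}}\mathbb{P}\left(V_j\le R_n-c\sqrt{R_n}\right)+o(1).$$ *)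

(* Defs.v *)
From HB Require Import structures.
From mathcomp Require Import all_boot all_order all_algebra finmap.
From mathcomp Require Import all_classical all_reals all_analysis.
Set Implicit Arguments.
Unset Strict Implicit.
Unset Printing Implicit Defensive.
Import Order.TTheory GRing.Theory Num.Theory.
Import numFieldNormedType.Exports.
Local Open Scope classical_set_scope.
Local Open Scope ring_scope.

Section lambert.
Variable R : realType.
Implicit Types n j : nat.

(* Only meaningful for 1 <= n, see [W_spec] and [W_unique]. *)
Definition W n : R := get [set w : R | 0 < w /\ w * expR w = n%:R].

Lemma W_spec n : (1 <= n)%N -> 0 < W n /\ W n * expR (W n) = n%:R.
Proof.
move=> n1; rewrite /W.
suff [w Hw] : exists w : R, 0 < w /\ w * expR w = n%:R.
  exact: (@getI _ [set w : R | 0 < w /\ w * expR w = n%:R] w).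
have cf : {within `[0, n%:R : R], continuous (fun w : R => w * expR w)}.
  apply: continuous_subspaceT => x.
  by apply: cvgM; [exact: cvg_id | exact: continuous_expR].
have n0 : 0 < n%:R :> R by rewrite ltr0n.
have le1 : n%:R <= n%:R * expR (n%:R : R).
  by rewrite ler_peMr ?ler0n// -[leLHS]expR0 ler_expR ler0n.
have [||w] := @IVT R _ 0 n%:R n%:R _ cf.
- exact: ltW.
- by rewrite mul0r ge_min le_max ler0n le1 orbT.
rewrite in_itv /= => /andP[w0 _] Hw; exists w; split => //.
rewrite lt_neqAle w0 andbT; apply/eqP => w00.
by move: n0; rewrite -Hw -w00 mul0r ltxx.
Qed.

Lemma W_unique n (w : R) : (1 <= n)%N ->
  0 < w -> w * expR w = n%:R -> w = W n.
Proof.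
move=> n1 w0 Hw; have [W0 HW] := W_spec n1.
have mono (x y : R) : 0 < x -> x < y -> x * expR x < y * expR y.
  by move=> x0 xy; rewrite ltr_pM ?expR_ge0 ?ltr_expR// ltW.
have [lt_w|lt_w|//] := ltgtP w (W n).
- by have := mono _ _ w0 lt_w; rewrite Hw HW ltxx.
- by have := mono _ _ W0 lt_w; rewrite Hw HW ltxx.
Qed.

Definition dW n : nat := Num.truncn (W n).

Definition lam n j : R := W n ^+ j / j`!%:R.

Definition RW n : R := lam n (dW n).

Definition Phi (x : R) : R := fine (normal_prob 0 1 `]-oo, x]).

End lambert.

Section random_variables.
Context d (T : measurableType d) (R : realType) (P : probability T R).

(* The second argument of [poisson_prob] is a dummy. *)
Definition poisson_distributed (X : {RV P >-> nat}) (r : R) : Prop :=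
  distribution P X = poisson_prob r 0%N :> (set nat -> \bar R).

Definition mutually_independent d' (T' : measurableType d') (I : choiceType)
    (D : set I) (X : I -> {RV P >-> T'}) : Prop :=
  forall (J : {fset I}) (A : I -> set T'),
    [set` J] `<=` D -> (forall i, measurable (A i)) ->
    P (\bigcap_(i in [set` J]) X i @^-1` A i) =
    (\prod_(i <- J) P (X i @^-1` A i))%E.

(* The maximum over j >= 1, as a supremum in the extended reals; it is +oo
   exactly where the sequence is unbounded. *)
Definition Vmax (V : nat -> {RV P >-> nat}) (w : T) : \bar R :=
  ereal_sup [set ((V j w)%:R : R)%:E | j in [set j | (1 <= j)%N]].

Definition prob_le (X : {RV P >-> nat}) (x : R) : R :=
  fine (P [set w | (X w)%:R <= x]).

End random_variables.

(* Main.v *)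
Require Import Defs.
From HB Require Import structures.
From mathcomp Require Import all_boot all_order all_algebra finmap.
From mathcomp Require Import all_classical all_reals all_analysis.
From mathcomp Require Import ring lra.
Set Implicit Arguments.
Unset Strict Implicit.
Unset Printing Implicit Defensive.
Import Order.TTheory GRing.Theory Num.Theory.
Import numFieldNormedType.Exports.
Local Open Scope classical_set_scope.
Local Open Scope ring_scope.

(* Idea.  Apart from [lambda_(d-1)], [lambda_d] and [lambda_(d+1)], every
   [lambda_j] is at most [(1 - 1/(d+2)) R_n].  For such [j] the Chernoff bound
   with parameter [t = 1/(4(d+2))], combined with
     [P(V > m+1) <= l * P(V > m)],
   gives [P(V_j > R_n - c sqrt R_n) <= lambda_j exp(c^2 + 1 - R_n t^2)]; the
   factor [lambda_j] makes these bounds summable, with sum at most [e^W <= n]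
   times the exponential.

   The second claim is the central limit theorem for Poisson variables.  As a
   function of the parameter, the Poisson cdf at [m] has derivative
   [- l^m e^-l / m!]; in the variable [z = (m - l) / sqrt m] this derivative is
   uniformly on compacts close to a constant multiple of the normal density.  So
   increments of the cdf are nearly proportional to increments of [Phi], and
   Chernoff bounds at a large [z = A] and at [-A] show that the constant tends
   to 1: Stirling's formula is not needed. *)

(** * Poisson distribution functions *)

Section poisson_cdf.
Variable R : realType.
Implicit Types (l t z : R) (m n k : nat).

(** The distribution function at [m] of the Poisson law of parameter [l]: [series _ m.+1] sums the
    indices [0..m]. As a closed formula in [l] it can be differentiated. *)
Definition pcdf m l : R := series (exp_coeff l) m.+1 * expR (- l).

Lemma expR_ge1 t : (1 <= expR t) = (0 <= t).
Proof. by rewrite -[RHS]ler_expR expR0. Qed.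

Lemma exp_coeff_ge0 l k : 0 <= l -> 0 <= exp_coeff l k.
Proof. by move=> l0; rewrite /exp_coeff/= divr_ge0 ?exprn_ge0. Qed.

Lemma series_exp_coeffS l n :
  series (exp_coeff l) n.+1 = series (exp_coeff l) n + exp_coeff l n.
Proof. by rewrite /series/= big_nat_recr. Qed.

Lemma series_exp_coeff_le l n : 0 <= l -> series (exp_coeff l) n <= expR l.
Proof.
move=> l0; apply: nondecreasing_cvgn_le; last exact: is_cvg_series_exp_coeff.
by apply/nondecreasing_seqP => k; rewrite series_exp_coeffS lerDl exp_coeff_ge0.
Qed.

Lemma series_exp_coeff_ler_expR l n x :
  (forall k, (n <= k)%N -> series (exp_coeff l) k <= x) -> expR l <= x.
Proof.
move=> H; apply: limr_le; first exact: is_cvg_series_exp_coeff.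
by exists n.
Qed.

Lemma pcdf_ge0 m l : 0 <= l -> 0 <= pcdf m l.
Proof.
move=> l0; rewrite mulr_ge0 ?expR_ge0//.
by apply: sumr_ge0 => k _; exact: exp_coeff_ge0.
Qed.

Lemma pcdf_le1 m l : 0 <= l -> pcdf m l <= 1.
Proof.
move=> l0; rewrite /pcdf -(expRxMexpNx_1 l) ler_pM2r ?expR_gt0//.
exact: series_exp_coeff_le.
Qed.

(** From [1 - t <= e^-t] comes [e^t <= 1 / (1 - t)], and [(1 - t)(1 + t + 2 t^2) = 1 + t^2 (1 - 2 t)
    >= 1]. *)
Lemma expR_le_quadratic t : t <= 2^-1 -> expR t <= 1 + t + 2 * t ^+ 2.
Proof.
move=> t2; have t1 : 0 < 1 - t by lra.
rewrite -[leLHS]invrK -expRN; apply: (@le_trans _ _ (1 - t)^-1).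
  rewrite lef_pV2 ?posrE ?expR_gt0//.
  by have := expR_ge1Dx (- t); rewrite addrC; lra.
rewrite -(ler_pM2l t1) mulfV ?gt_eqF//.
have := sqr_ge0 t; nra.
Qed.

Lemma exp_coeff_scale l t k :
  exp_coeff (l * expR t) k = exp_coeff l k * expR (t * k%:R).
Proof. by rewrite /exp_coeff/= exprMn -expRM_natr mulrAC. Qed.

(** Exponential tilting: for [k <= m] the factor [e^(t (m - k))] is at least 1, and it turns the
    weights into those of parameter [l e^-t], whose sum is at most an exponential. *)
Lemma pcdf_chernoff_le m l t : 0 <= l -> 0 <= t ->
  pcdf m l <= expR (l * (expR (- t) - 1) + t * m%:R).
Proof.
move=> l0 t0.
have -> : l * (expR (- t) - 1) + t * m%:R
    = l * expR (- t) + t * m%:R + (- l) by ring.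
rewrite expRD ler_pM2r ?expR_gt0// expRD.
have lt0 : 0 <= l * expR (- t) by rewrite mulr_ge0 ?expR_ge0.
apply: le_trans (ler_wpM2r (expR_ge0 _) (series_exp_coeff_le m.+1 lt0)).
rewrite /series/= mulr_suml !big_mkord; apply: ler_sum => k _.
rewrite exp_coeff_scale -mulrA -expRD; apply: ler_peMr.
  exact: exp_coeff_ge0.
have : 0 <= - t * k%:R + t * m%:R.
  by rewrite mulNr addrC subr_ge0 ler_wpM2l// ler_nat -ltnS.
by rewrite -expR_ge1.
Qed.

Lemma pcdf_chernoff_ge m l t : 0 <= l -> 0 <= t ->
  1 - pcdf m l <= expR (l * (expR t - 1) - t * m%:R).
Proof.
move=> l0 t0.
have -> : l * (expR t - 1) - t * m%:R
    = l * expR t - t * m%:R + (- l) by ring.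
rewrite expRD -[X in X - pcdf _ _](expRxMexpNx_1 l) -mulrBl.
rewrite ler_pM2r ?expR_gt0//.
have lt0 : 0 <= l * expR t by rewrite mulr_ge0 ?expR_ge0.
(* The tail is an infinite sum; it is enough to bound its truncations at [k > m], which are then
   tilted towards [l e^t]. *)
rewrite lerBlDr; apply: (@series_exp_coeff_ler_expR _ m.+1) => k mk.
rewrite {1}/series/= (@big_cat_nat _ _ _ m.+1)//= addrC lerD2r.
rewrite expRD.
apply: le_trans (ler_wpM2r (expR_ge0 _) (series_exp_coeff_le k lt0)).
rewrite /series/= mulr_suml [leRHS](@big_cat_nat _ _ _ m.+1)//=.
apply: ler_wpDl.
  by apply: sumr_ge0 => i _; rewrite mulr_ge0 ?expR_ge0 ?exp_coeff_ge0.
rewrite !big_nat; apply: ler_sum => i /andP[mi _].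
rewrite exp_coeff_scale -mulrA -expRD; apply: ler_peMr.
  exact: exp_coeff_ge0.
have : 0 <= t * i%:R - t * m%:R.
  by rewrite subr_ge0 ler_wpM2l// ler_nat ltnW.
by rewrite -expR_ge1.
Qed.

(** Termwise [l^(i+1)/(i+1)! <= l l^i/i!]. The factor [l] gained here makes the tails of the [V_j]
    summable over [j]. *)
Lemma pcdf_tailS m l : 0 <= l -> 1 - pcdf m.+1 l <= l * (1 - pcdf m l).
Proof.
move=> l0; rewrite /pcdf -[X in X - _](expRxMexpNx_1 l).
rewrite -[X in l * (X - _)](expRxMexpNx_1 l) -!mulrBl mulrA.
rewrite ler_pM2r ?expR_gt0// lerBlDr.
apply: (@series_exp_coeff_ler_expR _ m.+2) => -[//|k] /ltnSE mk.
rewrite {1}/series/= (@big_cat_nat _ _ _ m.+2)//= addrC lerD2r.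
rewrite big_add1/=.
apply: (@le_trans _ _ (l * \sum_(m.+1 <= i < k) exp_coeff l i)).
  rewrite mulr_sumr; apply: ler_sum => i _.
  rewrite /exp_coeff/= exprS factS natrM invfM -mulrA ler_wpM2l//.
  rewrite mulrCA; apply: ler_piMl; first by rewrite divr_ge0 ?exprn_ge0.
  by rewrite invf_le1 ?ltr0Sn// ler1n.
rewrite ler_wpM2l// lerBrDr.
have := series_exp_coeff_le k l0.
by rewrite {1}/series/= (@big_cat_nat _ _ _ m.+1)//= addrC.
Qed.

Lemma is_derive_expRN l : is_derive l 1 (expR \o -%R) (- expR (- l)).
Proof. by apply: is_derive_eq; rewrite mulrN1. Qed.

(** The derivative telescopes: the term of index [m + 1] contributes
    [(l^m/m! - l^(m+1)/(m+1)!) e^-l], whose first part cancels the derivative found so far. *)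
Lemma is_derive_pcdf m l :
  is_derive l 1 (pcdf m) (- (exp_coeff l m * expR (- l))).
Proof.
have De := is_derive_expRN l.
elim: m => [|m IH].
  rewrite (_ : pcdf 0 = expR \o -%R); last first.
    apply/funext => x; rewrite /pcdf series_exp_coeffS /series/= big_nil add0r.
    by rewrite /exp_coeff/= expr0 fact0 divr1 mul1r.
  by apply: is_derive_eq; rewrite /exp_coeff/= expr0 fact0 divr1 mul1r.
rewrite (_ : pcdf m.+1 = pcdf m
    + (m.+1`!%:R^-1 \*: ((@id R) ^+ m.+1 * (expR \o -%R))))%R; last first.
  apply/funext => x; rewrite /pcdf [in LHS]series_exp_coeffS mulrDl.
  by rewrite /exp_coeff/= !fctE /GRing.scale/= mulrAC (mulrC _ (_^-1)).
apply: is_derive_eq.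
rewrite /exp_coeff/= /GRing.scale/= fctE factS natrM invfM.
have : (m.+1%:R : R) != 0 by rewrite pnatr_eq0.
have : (m`!%:R : R) != 0 by rewrite pnatr_eq0 -lt0n fact_gt0.
move: (m.+1%:R : R) => a; move: (m`!%:R : R) => b b0 a0.
by field; rewrite b0 a0.
Qed.

End poisson_cdf.

(** * The normal distribution function *)

Section normal_cdf.
Variable R : realType.
Implicit Types (x y z : R).

Lemma is_derive_Phi z : is_derive z 1 (@Phi R) (normal_pdf 0 1 z).
Proof.
(* The fundamental theorem of calculus is applied on an interval reaching past [z]; its right end
   [z + 1] is arbitrary. *)
have iN : (@lebesgue_measure R).-integrable [set` `]-oo, z + 1]]
    (EFin \o normal_pdf 0 1).
  apply: (integrableS _ _ (@subsetT _ _)) => //.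
  exact: integrable_normal_pdf.
have cN : {for z, continuous (normal_pdf (0 : R) 1)}.
  exact: (continuous_normal_pdf (oner_neq0 R)).
have zz : z < z + 1 by rewrite ltrDl.
have [dF F'] := continuous_FTC1 zz iN (ltNyr _) cN.
apply: DeriveDef; first exact: dF.
by rewrite -derive1E; exact: F'.
Qed.

(** The identity as a random variable under the normal law: [Phi] becomes its [cdf], whose bounds
    and limits at infinity are known. *)
Let idR : measurableTypeR R -> R := idfun.

#[local] HB.instance Definition _ :=
  @isMeasurableFun.Build _ _ _ _ idR (@measurable_id _ _ setT).

Let Phi_cdf x :
  Phi x = fine (cdf (idR : {RV (normal_prob (0 : R) 1) >-> R}) x).
Proof. by rewrite /cdf /distribution /pushforward/= preimage_id. Qed.

Lemma Phi_ge0 x : 0 <= Phi x.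
Proof. by rewrite Phi_cdf fine_ge0// cdf_ge0. Qed.

Lemma Phi_le1 x : Phi x <= 1.
Proof.
rewrite Phi_cdf -[leRHS]/(fine 1%E) fine_le// ?cdf_le1//.
by rewrite fin_num_measure.
Qed.

Lemma cvg_Phiy : Phi x @[x --> +oo] --> (1 : R).
Proof.
rewrite (_ : @Phi R = fine \o cdf (idR : {RV (normal_prob (0 : R) 1) >-> R})).
  by apply: fine_cvg; exact: cvg_cdfy1.
by apply/funext => x; exact: Phi_cdf.
Qed.

Lemma cvg_PhiNy : Phi x @[x --> -oo] --> (0 : R).
Proof.
rewrite (_ : @Phi R = fine \o cdf (idR : {RV (normal_prob (0 : R) 1) >-> R})).
  by apply: fine_cvg; exact: cvg_cdfNy0.
by apply/funext => x; exact: Phi_cdf.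
Qed.

Lemma continuous_Phi : continuous (@Phi R).
Proof.
move=> x; apply: differentiable_continuous; apply/derivable1_diffP.
by apply: ex_derive; exact: is_derive_Phi.
Qed.

Lemma normal_pdf01E x :
  normal_pdf 0 1 x = normal_peak 1 * expR (- (x ^+ 2 / 2)) :> R.
Proof.
by rewrite normal_pdfE ?oner_neq0// /normal_fun subr0 expr1n mulNr.
Qed.

End normal_cdf.

(** Mean value theorem for [g - f]. Taking a multiple of [id] or of [Phi] on one side turns bounds
    on a derivative into bounds on increments. *)
Lemma le_increment_derive (R : realType) (f g df dg : R -> R) (a b : R) :
  a <= b ->
  (forall x, x \in `[a, b] -> is_derive x 1 f (df x)) ->
  (forall x, x \in `[a, b] -> is_derive x 1 g (dg x)) ->
  (forall x, x \in `[a, b] -> df x <= dg x) ->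
  f b - f a <= g b - g a.
Proof.
move=> ab Hf Hg Hle.
have Hd x : x \in `[a, b] -> is_derive x 1 (g - f) (dg x - df x).
  by move=> xab; have := Hf _ xab; have := Hg _ xab => ? ?; exact: is_deriveB.
have Hd' : forall x, x \in `]a, b[ ->
    is_derive x 1 (g - f) ((fun x => dg x - df x) x).
  by move=> x xab; apply: Hd; exact: subset_itv_oo_cc xab.
have Hc : {within `[a, b], continuous (g - f)}.
  apply: derivable_within_continuous => x xab.
  by apply: ex_derive; exact: Hd.
have [c cab] := MVT_segment ab Hd' Hc.
rewrite /= !fctE => E; have : 0 <= (dg c - df c) * (b - a).
  by rewrite mulr_ge0// subr_ge0// Hle.
by rewrite -E; lra.
Qed.

(** * Central limit theorem for Poisson variables *)

Section central_limit.
Variable R : realType.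
Implicit Types (u z l s : R) (m : nat).

(** The remainder of the second-order expansion of [ln (1 - u)] at 0; its derivative is
    [- u^2 / (1 - u)]. *)
Let k u := ln (1 - u) + u + u ^+ 2 / 2.

(** On [[-M, M]] with [M <= 1/2], the derivative of [k] lies between [- 2 M^2] and 0. *)
Lemma ln1B_increment (M a b : R) : a <= b -> M <= 2^-1 ->
  - M <= a -> b <= M ->
  - (2 * M ^+ 2) * (b - a) <= k b - k a <= 0.
Proof.
move=> ab M2 Ma bM.
pose dk u := - (u ^+ 2 / (1 - u)) : R.
have xM x : x \in `[a, b] -> -M <= x /\ x <= M.
  by rewrite in_itv/= => /andP[ax xb]; split; lra.
have Hk x : x \in `[a, b] -> is_derive x 1 k (dk x).
  move=> /xM[Mx xleM]; have x1 : 0 < 1 - x by lra.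
  have ? := is_derive1_ln x1.
  rewrite (_ : k = (@ln R \o (cst 1 - id)) + id
      + (2^-1 \*: ((@id R) ^+ 2)))%R; last first.
    by apply/funext => y; rewrite !fctE/= /k /GRing.scale/= [in RHS]mulrC.
  apply: is_derive_eq; rewrite /dk /GRing.scale/=.
  by field; rewrite ?gt_eqF.
have Hc (C x : R) : is_derive x 1 (C \*: (@id R)) C.
  by apply: is_derive_eq; rewrite /GRing.scale/= mulr1.
apply/andP; split.
  have := @le_increment_derive _ (- (2 * M ^+ 2) \*: id) k
    (cst (- (2 * M ^+ 2))) dk a b ab (fun x _ => Hc _ x) Hk.
  rewrite /= /GRing.scale/= mulrBr; apply => x /xM[Mx xleM].
  rewrite /dk lerN2 ler_pdivrMr; last by lra.
  by nra.
have := @le_increment_derive _ k (0 \*: id) dk (cst 0) a b ab Hk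
  (fun x _ => Hc _ x).
rewrite /= /GRing.scale/= !mul0r subrr; apply => x /xM[Mx xleM].
by rewrite /dk oppr_le0 divr_ge0 ?sqr_ge0//; lra.
Qed.

Lemma ln1B_taylor2 u : `|u| <= 2^-1 ->
  `|ln (1 - u) + u + u ^+ 2 / 2| <= 2 * `|u| ^+ 3.
Proof.
move=> u2.
have k0 : k 0 = 0.
  by rewrite /k subr0 ln1 expr0n/= mul0r !addr0.
rewrite -/(k u); have [u0|u0] := leP 0 u.
  have uu : `|u| = u by rewrite ger0_norm.
  have := @ln1B_increment `|u| 0 u u0 u2.
  rewrite uu k0 oppr_le0 => /(_ u0 (lexx _)) /andP[k1 k2].
  by rewrite ler_norml; apply/andP; split; nra.
have uu : `|u| = - u by rewrite ltr0_norm.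
have := @ln1B_increment `|u| u 0 (ltW u0) u2.
rewrite k0 uu opprK oppr_ge0 => /(_ (lexx _) (ltW u0)) /andP[k1 k2].
by rewrite ler_norml; apply/andP; split; nra.
Qed.

(* Increasing in [z], like [Phi]. *)
Definition scaled_pcdf m z : R := pcdf m (m%:R - z * Num.sqrt m%:R).

(** The derivative of [scaled_pcdf m] at 0, to be compared with [normal_peak 1], the normal density
    at 0. *)
Definition scaled_peak m : R :=
  Num.sqrt m%:R * exp_coeff m%:R m * expR (- m%:R).

Lemma scaled_peak_gt0 m : (0 < m)%N -> 0 < scaled_peak m.
Proof.
move=> m0; rewrite /scaled_peak mulr_gt0 ?expR_gt0// mulr_gt0//.
  by rewrite sqrtr_gt0 ltr0n.
by rewrite /exp_coeff/= divr_gt0 ?exprn_gt0 ?ltr0n// fact_gt0.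
Qed.

(** Put [u = z / sqrt m], so that [l = m (1 - u)] and [l^m e^-l = m^m e^-m exp (m (ln (1 - u) +
    u))]; the exponent is close to [- z^2 / 2]. *)
Lemma is_derive_scaled_pcdf m z : (0 < m)%N -> z < Num.sqrt m%:R ->
  is_derive z 1 (scaled_pcdf m)
    (scaled_peak m * expR (m%:R * (ln (1 - z / Num.sqrt m%:R)
                                    + z / Num.sqrt m%:R))).
Proof.
move=> m0 zs; have s0 : 0 < Num.sqrt m%:R :> R by rewrite sqrtr_gt0 ltr0n.
have sE : Num.sqrt m%:R ^+ 2 = m%:R :> R by rewrite sqr_sqrtr.
set s := Num.sqrt m%:R in zs s0 sE *.
have Hp := is_derive_pcdf m (m%:R - z * s).
have Hl : is_derive z 1 (cst (m%:R : R) - s \*: (@id R)) (- s).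
  by apply: is_derive_eq; rewrite /GRing.scale/= mulr1 sub0r.
rewrite (_ : scaled_pcdf m = pcdf m \o (cst (m%:R : R) - s \*: (@id R))).
  have Hp' : is_derive ((cst (m%:R : R) - s \*: (@id R)) z) 1 (pcdf m)
     (- (exp_coeff (m%:R - z * s) m * expR (- (m%:R - z * s)))).
    have -> : (cst (m%:R : R) - s \*: (@id R)) z = m%:R - z * s.
      by congr (_ - _); exact: mulrC.
    exact: Hp.
  apply: is_derive_eq.
  have u0 : 0 < 1 - z / s by rewrite subr_gt0 ltr_pdivrMr// mul1r.
  have lE : m%:R - z * s = m%:R * (1 - z / s).
    by rewrite -sE; field; rewrite gt_eqF.
  rewrite mulrN mulNr opprK lE /exp_coeff/= exprMn.
  have -> : (1 - z / s) ^+ m = expR (m%:R * ln (1 - z / s)).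
    by rewrite expRM_natl lnK.
  have -> : - (m%:R * (1 - z / s)) = - m%:R + m%:R * (z / s) by ring.
  rewrite /scaled_peak -/s /exp_coeff/= [in RHS]mulrDr !expRD.
  by ring.
by apply/funext => y; rewrite /scaled_pcdf !fctE /GRing.scale/= -/s mulrC.
Qed.

(** Chernoff with [t = 1 / sqrt m] leaves the exponent [- A + 2 + 2 A / sqrt m]. The decay in [A] is
    only exponential, but uniform in [m], which suffices. *)
Lemma scaled_pcdf_lower m (A : R) : (0 < m)%N -> 0 <= A ->
  A <= Num.sqrt m%:R -> scaled_pcdf m (- A) <= expR (4 - A).
Proof.
move=> m0 A0; have s0 : 0 < Num.sqrt m%:R :> R by rewrite sqrtr_gt0 ltr0n.
have sE : Num.sqrt m%:R ^+ 2 = m%:R :> R by rewrite sqr_sqrtr.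
rewrite /scaled_pcdf; set s := Num.sqrt m%:R in s0 sE * => As.
have l0 : 0 <= m%:R - - A * s by rewrite mulNr opprK addr_ge0 ?mulr_ge0// ltW.
apply: (le_trans (pcdf_chernoff_le m l0 (ltW _ : 0 <= s^-1))).
  by rewrite invr_gt0.
rewrite ler_expR.
have /(ler_wpM2l l0) : expR (- s^-1) - 1 <= - s^-1 + 2 * s^-1 ^+ 2.
  rewrite lerBlDr addrC addrA -(sqrrN (s^-1)); apply: expR_le_quadratic.
  by rewrite (@le_trans _ _ 0)// oppr_le0 invr_ge0 ltW.
rewrite -(lerD2r (s^-1 * m%:R)) => /le_trans; apply.
have -> : (m%:R - - A * s) * (- s^-1 + 2 * s^-1 ^+ 2) + s^-1 * m%:R
    = - A + 2 + 2 * (A / s).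
  by rewrite -sE; field; rewrite gt_eqF.
have : A / s <= 1 by rewrite ler_pdivrMr// mul1r.
by lra.
Qed.

Lemma scaled_pcdf_upper m (A : R) : (0 < m)%N -> 0 <= A ->
  A <= Num.sqrt m%:R -> 2 <= Num.sqrt m%:R :> R ->
  1 - scaled_pcdf m A <= expR (4 - A).
Proof.
move=> m0 A0; have s0 : 0 < Num.sqrt m%:R :> R by rewrite sqrtr_gt0 ltr0n.
have sE : Num.sqrt m%:R ^+ 2 = m%:R :> R by rewrite sqr_sqrtr.
rewrite /scaled_pcdf; set s := Num.sqrt m%:R in s0 sE * => As s2.
have l0 : 0 <= m%:R - A * s by rewrite -sE; nra.
apply: (le_trans (pcdf_chernoff_ge m l0 (ltW _ : 0 <= s^-1))).
  by rewrite invr_gt0.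
rewrite ler_expR.
have /(ler_wpM2l l0) : expR (s^-1) - 1 <= s^-1 + 2 * s^-1 ^+ 2.
  rewrite lerBlDr addrC addrA; apply: expR_le_quadratic.
  by rewrite lef_pV2 ?posrE.
rewrite -(lerD2r (- (s^-1 * m%:R))) => /le_trans; apply.
have -> : (m%:R - A * s) * (s^-1 + 2 * s^-1 ^+ 2) - s^-1 * m%:R
    = - A + 2 - 2 * (A / s).
  by rewrite -sE; field; rewrite gt_eqF.
have : 0 <= A / s by rewrite divr_ge0// ltW.
by lra.
Qed.

(* [h0, h, h1] and [p0, p, p1] stand for the values of two distribution
   functions at [-A, z, A], whose increments are in the ratio [D] up to a
   factor [E]; the total increments, both close to 1, force [D] to be close
   to 1. *)
Lemma proportional_increments (h0 h h1 p0 p p1 D E eta : R) :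
  0 < D -> 1 <= E -> E ^+ 2 <= 1 + eta -> 0 < eta -> eta <= 4^-1 ->
  D / E * (p1 - p0) <= h1 - h0 ->
  h - h0 <= D * E * (p - p0) -> h1 - h <= D * E * (p1 - p) ->
  0 <= h0 <= eta -> 1 - eta <= h1 <= 1 ->
  0 <= p0 <= eta -> 1 - eta <= p1 <= 1 -> p0 <= p <= p1 ->
  `|h - p| <= 7 * eta.
Proof.
move=> D0 E1 E2 eta0 eta4 tot lo up /andP[h00 h0e] /andP[h1e h11].
move=> /andP[p00 p0e] /andP[p1e p11] /andP[p0p pp1].
have E0 : 0 < E by lra.
have DE0 : 0 < D * E by rewrite mulr_gt0.
have : D / E * (p1 - p0) <= 1 by lra.
rewrite mulrAC ler_pdivrMr// mul1r => tot'.
(* Here [p1 - p0 >= 1 - 2 eta], and [(1 + 6 eta)(1 - 2 eta) >= 1 + eta] because [eta <= 1/4]. *)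
have K : D * E <= 1 + 6 * eta.
  have : D * E * (p1 - p0) <= 1 + eta.
    by apply: le_trans E2; rewrite mulrAC expr2 ler_pM2r.
  move: (D * E) DE0 => K K0 KK; nra.
move: (D * E) DE0 K lo up => {}K K0 K6 lo up.
(* Upper bounds on increments serve both sides: going down from [h1] bounds [h] from below, going up
   from [h0] bounds it from above. *)
rewrite ler_norml; apply/andP; split.
- have : K * (p1 - p) <= (1 + 6 * eta) * (p1 - p).
    by rewrite ler_wpM2r// subr_ge0.
  have : eta * (p1 - p) <= eta by rewrite ler_piMr; lra.
  lra.
- have : K * (p - p0) <= (1 + 6 * eta) * (p - p0).
    by rewrite ler_wpM2r// subr_ge0.
  have : eta * (p - p0) <= eta by rewrite ler_piMr; lra.
  lra.
Qed.

End central_limit.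

(** * Locally uniform convergence of the rescaled Poisson distribution functions *)

Section central_limit_cvg.
Variable R : realType.
Implicit Types (z l : R) (m : nat).

(** By the cubic remainder bound, the exponent of the derivative differs from [- x^2 / 2] by at most
    [2 A^3 / sqrt m <= e] on [[-A, A]]; [2 A <= sqrt m] keeps [|x / sqrt m|] below [1/2]. *)
Lemma scaled_pcdf_increment m (A e a b : R) : (0 < m)%N -> 0 < e ->
  2 * A <= Num.sqrt m%:R -> 2 * A ^+ 3 <= e * Num.sqrt m%:R ->
  - A <= a -> a <= b -> b <= A ->
  let D := scaled_peak R m / normal_peak 1 in
  D / expR e * (Phi b - Phi a) <= scaled_pcdf m b - scaled_pcdf m a /\
  scaled_pcdf m b - scaled_pcdf m a <= D * expR e * (Phi b - Phi a).
Proof.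
move=> m0 e0 As Ae Aa ab bA D.
have s0 : 0 < Num.sqrt m%:R :> R by rewrite sqrtr_gt0 ltr0n.
have sE : Num.sqrt m%:R ^+ 2 = m%:R :> R by rewrite sqr_sqrtr.
have D0 : 0 < scaled_peak R m by exact: scaled_peak_gt0.
have np0 : 0 < normal_peak 1 :> R by rewrite normal_peak_gt0// oner_neq0.
set s := Num.sqrt m%:R in As Ae s0 sE *.
pose q x := m%:R * (ln (1 - x / s) + x / s) : R.
have xA x : x \in `[a, b] -> `|x| <= A.
  rewrite in_itv/= => /andP[ax xb].
  by rewrite ler_norml; apply/andP; split; lra.
have HH x : x \in `[a, b] ->
    is_derive x 1 (scaled_pcdf m) (scaled_peak R m * expR (q x)).
  move=> /xA; rewrite ler_norml => /andP[Ax xleA].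
  by apply: is_derive_scaled_pcdf => //; rewrite -/s; lra.
have HP (C x : R) :
    is_derive x 1 (C \*: @Phi R) (C * (normal_peak 1 * expR (- (x ^+ 2 / 2)))).
  have ? := is_derive_Phi x.
  by apply: is_derive_eq; rewrite normal_pdf01E.
have qx x : x \in `[a, b] -> `|q x + x ^+ 2 / 2| <= e.
  move=> /xA xleA; have u2 : `|x / s| <= 2^-1.
    by rewrite normrM normfV (gtr0_norm s0) ler_pdivrMr//; lra.
  have -> : q x + x ^+ 2 / 2
      = m%:R * (ln (1 - x / s) + x / s + (x / s) ^+ 2 / 2).
    by rewrite /q [in RHS]mulrDr -[in X in _ = _ + X]sE; field; rewrite gt_eqF.
  rewrite normrM ger0_norm//.
  apply: (le_trans (ler_wpM2l _ (ln1B_taylor2 u2))) => //.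
  rewrite normrM normfV (gtr0_norm s0) exprMn -sE exprVn.
  have -> : s ^+ 2 * (2 * (`|x| ^+ 3 * (s ^+ 3)^-1)) = 2 * `|x| ^+ 3 / s.
    by field; rewrite gt_eqF.
  rewrite ler_pdivrMr//; apply: le_trans Ae.
  by rewrite ler_wpM2l// lerXn2r// nnegrE (le_trans _ xleA).
split.
- have := le_increment_derive ab (fun x _ => HP (D / expR e) x) HH.
  rewrite /GRing.scale/= mulrBr; apply => x /qx.
  rewrite ler_norml => /andP[q1 q2].
  have -> : D / expR e * (normal_peak 1 * expR (- (x ^+ 2 / 2)))
      = scaled_peak R m * expR (- (x ^+ 2 / 2) - e).
    by rewrite expRB /D; field; rewrite !gt_eqF ?expR_gt0.
  by rewrite ler_pM2l// ler_expR; lra.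
- have := le_increment_derive ab HH (fun x _ => HP (D * expR e) x).
  rewrite /GRing.scale/= mulrBr; apply => x /qx.
  rewrite ler_norml => /andP[q1 q2].
  have -> : D * expR e * (normal_peak 1 * expR (- (x ^+ 2 / 2)))
      = scaled_peak R m * expR (- (x ^+ 2 / 2) + e).
    by rewrite expRD /D; field; rewrite !gt_eqF.
  by rewrite ler_pM2l// ler_expR; lra.
Qed.

Lemma Phi_homo : {homo @Phi R : x y / x <= y}.
Proof.
move=> x y xy.
have := @le_increment_derive _ (cst 0) (@Phi R) (cst 0) (normal_pdf 0 1) x y xy
  (fun z _ => is_derive_cst 0 z 1) (fun z _ => is_derive_Phi z)
  (fun z _ => normal_pdf_ge0 0 1 z).
by rewrite /= subrr subr_ge0.
Qed.

Lemma scaled_pcdf_cvg (B e : R) : 0 < e ->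
  \forall m \near \oo, forall z, `|z| <= B -> `|scaled_pcdf m z - Phi z| <= e.
Proof.
(* Both bounds are dictated by [proportional_increments]: the error [7 eta] and the condition
   [eta <= 1/4]. *)
move=> e0; pose eta := Num.min (e / 7) 4^-1.
have eta0 : 0 < eta by rewrite lt_min divr_gt0//=.
have etae : 7 * eta <= e.
  have : eta <= e / 7 by rewrite ge_min lexx.
  by lra.
have eta4 : eta <= 4^-1 by rewrite ge_min lexx orbT.
(* [4 - ln eta <= A] makes the Chernoff bound [e^(4 - A)] at most [eta], so both laws have little
   mass outside [[-A, A]]. *)
have [A [A0 [BA [AA [p1 p0]]]]] : exists A : R,
    0 <= A /\ B <= A /\ 4 - ln eta <= A /\ 1 - eta <= Phi A /\ Phi (- A) <= eta.
  have /cvgrPdist_le /(_ _ eta0) H1 := @cvg_Phiy R.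
  have /cvgrPdist_le /(_ _ eta0) H0 := @cvg_PhiNy R.
  near (+oo : set_system R) => A.
  exists A; split; [|split; [|split; [|split]]].
  - by near: A; apply: nbhs_pinfty_ge; exact: num_real.
  - by near: A; apply: nbhs_pinfty_ge; exact: num_real.
  - by near: A; apply: nbhs_pinfty_ge; exact: num_real.
  - have : `|1 - Phi A| <= eta by near: A; exact: H1.
    by rewrite ler_norml => /andP[]; lra.
  - have : `|0 - Phi (- A)| <= eta.
      by near: A; move: H0; rewrite -ninfty; exact.
    by rewrite ler_norml => /andP[]; lra.
(* Chosen so that [(e^E)^2 = 1 + eta]. *)
pose E := ln (1 + eta) / 2.
have E0 : 0 < E by rewrite divr_gt0// ln_gt0//; lra.
have etaA : expR (4 - A) <= eta.
  by rewrite -[leRHS]lnK ?posrE// ler_expR; lra.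
near=> m => z zB.
have m0 : (0 < m)%N by near: m; exists 1%N.
have bigm (K : R) : 0 <= K -> K ^+ 2 <= m%:R -> K <= Num.sqrt m%:R.
  by move=> K0 Km; rewrite -(ger0_norm K0) -sqrtr_sqr ler_wsqrtr.
have s2 : 2 <= Num.sqrt m%:R :> R.
  by apply: bigm => //; near: m; exact: nbhs_infty_ger.
have sA : 2 * A <= Num.sqrt m%:R :> R.
  by apply: bigm; [lra|near: m; exact: nbhs_infty_ger].
have sE : 2 * A ^+ 3 <= E * Num.sqrt m%:R :> R.
  rewrite -ler_pdivrMl//; apply: bigm; last first.
    by near: m; exact: nbhs_infty_ger.
  by rewrite mulr_ge0 ?invr_ge0 ?(ltW E0)// mulr_ge0// exprn_ge0.
have [zA1 zA2] : - A <= z /\ z <= A.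
  by move: zB; rewrite ler_norml => /andP[]; lra.
have D0 : 0 < scaled_peak R m / normal_peak 1.
  by rewrite divr_gt0 ?scaled_peak_gt0// normal_peak_gt0// oner_neq0.
have AA' : - A <= A by lra.
have [lo _] := scaled_pcdf_increment m0 E0 sA sE (lexx (- A)) AA' (lexx A).
have [_ up1] := scaled_pcdf_increment m0 E0 sA sE (lexx (- A)) zA1 zA2.
have [_ up2] := scaled_pcdf_increment m0 E0 sA sE zA1 zA2 (lexx A).
apply: (le_trans _ etae).
apply: (@proportional_increments _ (scaled_pcdf m (- A)) (scaled_pcdf m z)
  (scaled_pcdf m A) (Phi (- A)) (Phi z) (Phi A) _ (expR E) eta D0) => //.
- by rewrite expR_ge1 ltW.
- by rewrite -expRM_natl /E mulrC divfK// lnK// posrE; lra.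
- have l0 : 0 <= m%:R - - A * Num.sqrt m%:R.
    by rewrite mulNr opprK addr_ge0 ?mulr_ge0 ?sqrtr_ge0.
  rewrite (pcdf_ge0 _ l0).
  by apply: le_trans etaA; apply: scaled_pcdf_lower => //; lra.
- apply/andP; split.
    have : 1 - scaled_pcdf m A <= expR (4 - A).
      by apply: scaled_pcdf_upper => //; lra.
    by lra.
  apply: pcdf_le1.
  have sq : Num.sqrt m%:R * Num.sqrt m%:R = m%:R :> R.
    by rewrite -expr2 sqr_sqrtr.
  by rewrite subr_ge0 -[leRHS]sq ler_wpM2r ?sqrtr_ge0//; lra.
- by rewrite Phi_ge0.
- by rewrite Phi_le1 p1.
- by rewrite !Phi_homo.
Unshelve. all: by end_near. Qed.

End central_limit_cvg.

(** * Poisson central limit theorem for a parameter tending to infinity *)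

Section poisson_clt.
Variable R : realType.

Lemma truncn_bounds (x : R) : 0 <= x ->
  (Num.truncn x)%:R <= x /\ x < (Num.truncn x)%:R + 1.
Proof.
by move=> x0; have /andP[? ?] := truncn_itv x0; split=> //; rewrite natr1.
Qed.

(** Both the index [m n] and the argument of the rescaled distribution function move with [n], so
    locally uniform convergence is used along [z n], which tends to [- c]. *)
Lemma poisson_clt (l : R^nat) (c : R) : l n @[n --> \oo] --> +oo ->
  pcdf (Num.truncn (l n - c * Num.sqrt (l n))) (l n) @[n --> \oo]
    --> Phi (- c).
Proof.
move=> ly; pose s n := Num.sqrt (l n).
pose m n := Num.truncn (l n - c * s n).
have sy (K : R) : \forall n \near \oo, K <= s n.
  move/cvgryPge : ly => /(_ (`|K| ^+ 2)); apply: filterS => n Kn.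
  apply: (le_trans (ler_norm K)).
  by rewrite -(ger0_norm (normr_ge0 K)) -sqrtr_sqr ler_wsqrtr.
have l0 : \forall n \near \oo, l n = s n ^+ 2.
  move/cvgryPge : ly => /(_ 0); apply: filterS => n ln.
  by rewrite /s sqr_sqrtr.
have mb : \forall n \near \oo,
    s n ^+ 2 - c * s n - 1 <= (m n)%:R /\ (m n)%:R <= s n ^+ 2 - c * s n.
  near=> n; have sn : `|c| + 1 <= s n by near: n; exact: sy.
  have lE : l n = s n ^+ 2 by near: n; exact: l0.
  have x0 : 0 <= l n - c * s n.
    by rewrite lE; have := ler_norm c; have := normr_ge0 c; nra.
  by have [m1 m2] := truncn_bounds x0; rewrite /m -lE; split; lra.
have c1 : ((m n)%:R - s n ^+ 2) / s n @[n --> \oo] --> - c.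
  apply/cvgrPdist_le => e e0; near=> n.
  have s0 : 1 <= s n by near: n; exact: sy.
  have se : e^-1 <= s n by near: n; exact: sy.
  have [m1 m2] : s n ^+ 2 - c * s n - 1 <= (m n)%:R /\
      (m n)%:R <= s n ^+ 2 - c * s n by near: n.
  have es : 1 <= e * s n by rewrite -ler_pdivrMl// mulr1.
  have -> : - c - ((m n)%:R - s n ^+ 2) / s n
      = (s n ^+ 2 - c * s n - (m n)%:R) / s n by field; lra.
  have sn0 : 0 < s n by lra.
  rewrite normrM normfV (gtr0_norm sn0) ler_pdivrMr//.
  by rewrite ger0_norm; lra.
have c2 : (m n)%:R / s n ^+ 2 @[n --> \oo] --> (1 : R).
  apply/cvgrPdist_le => e e0; near=> n.
  have s0 : 1 <= s n by near: n; exact: sy.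
  have se : (`|c| + 1) / e <= s n by near: n; exact: sy.
  have [m1 m2] : s n ^+ 2 - c * s n - 1 <= (m n)%:R /\
      (m n)%:R <= s n ^+ 2 - c * s n by near: n.
  have s2 : 0 < s n ^+ 2 by rewrite exprn_gt0//; lra.
  have -> : 1 - (m n)%:R / s n ^+ 2 = (s n ^+ 2 - (m n)%:R) / s n ^+ 2.
    by rewrite mulrBl divff// gt_eqF.
  rewrite normrM normfV (gtr0_norm s2) ler_pdivrMr//.
  have es : `|c| + 1 <= e * s n by rewrite -ler_pdivrMl// mulrC.
  have : (`|c| + 1) * s n <= e * s n ^+ 2.
    by rewrite expr2 mulrA ler_pM2r//; lra.
  apply: le_trans.
  have cs : `|c * s n| = `|c| * s n.
    by rewrite normrM (ger0_norm (_ : 0 <= s n))//; lra.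
  have /andP[c3 c4] : - (`|c| * s n) <= c * s n <= `|c| * s n.
    by rewrite -ler_norml cs.
  by rewrite ler_norml; apply/andP; split; lra.
(* The solution of [l n = m n - z n sqrt (m n)], written as [(m - l) / sqrt l] divided by
   [sqrt (m / l)], with limits [- c] and 1. *)
pose z n := ((m n)%:R - s n ^+ 2) / s n / Num.sqrt ((m n)%:R / s n ^+ 2).
have cz : z n @[n --> \oo] --> - c.
  rewrite -[- c]divr1 -[X in _ / X]sqrtr1; apply: cvgM => //.
  apply: cvgV; first by rewrite sqrtr1 oner_neq0.
  by apply: continuous_cvg => //; exact: sqrt_continuous.
have Pz : Phi (z n) @[n --> \oo] --> Phi (- c).
  by apply: continuous_cvg => //; exact: continuous_Phi.
apply/cvgrPdist_le => e e0.
have e2 : 0 < e / 2 by rewrite divr_gt0.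
have [N _ HN] := scaled_pcdf_cvg (`|c| + 1) e2.
near=> n.
have s0 : 1 <= s n by near: n; exact: sy.
have sN : N%:R + 1 + `|c| + 1 <= s n by near: n; exact: sy.
have lE : l n = s n ^+ 2 by near: n; exact: l0.
have [m1 m2] : s n ^+ 2 - c * s n - 1 <= (m n)%:R /\
      (m n)%:R <= s n ^+ 2 - c * s n by near: n.
have mN : N%:R + 1 <= (m n)%:R :> R.
  apply: le_trans m1; have := ler_norm c; have := normr_ge0 c.
  have := ler0n R N; nra.
have Nm : (N <= m n)%N by rewrite -(ler_nat R); lra.
have zB : `|z n| <= `|c| + 1.
  have : `|- c - z n| <= 1 by near: n; move/cvgrPdist_le : cz; apply.
  have := ler_normB (- c) (- c - z n).
  by rewrite opprB addrC subrK normrN; lra.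
have Hm := HN _ Nm _ zB.
have PB : `|Phi (- c) - Phi (z n)| <= e / 2.
  by near: n; move/cvgrPdist_le : Pz; apply.
have -> : pcdf (m n) (l n) = scaled_pcdf (m n) (z n).
  rewrite /scaled_pcdf; congr pcdf.
  have m0 : 0 < (m n)%:R :> R by have := ler0n R N; lra.
  have sm : Num.sqrt (m n)%:R = Num.sqrt ((m n)%:R / s n ^+ 2) * s n.
    rewrite -[X in _ * X](ger0_norm (_ : 0 <= s n)); last by lra.
    rewrite -sqrtr_sqr -sqrtrM ?divr_ge0 ?sqr_ge0// divfK//.
    by rewrite gt_eqF// exprn_gt0//; lra.
  rewrite lE /z sm; have : 0 < Num.sqrt ((m n)%:R / s n ^+ 2).
    by rewrite sqrtr_gt0 divr_gt0// exprn_gt0//; lra.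
  by move=> r0; field; rewrite gt_eqF//=; lra.
have := ler_distD (Phi (z n)) (Phi (- c)) (scaled_pcdf (m n) (z n)).
by rewrite (distrC (Phi (z n))); lra.
Unshelve. all: by end_near. Qed.

End poisson_clt.

(** * Asymptotics of the Lambert parameters *)

Section lambert_asymptotics.
Variable R : realType.
Implicit Types (n j : nat).

Lemma W_gt0 n : (0 < n)%N -> 0 < W R n.
Proof. by move=> /(@W_spec R)[]. Qed.

Lemma lam_ge0 n j : (0 < n)%N -> 0 <= lam R n j.
Proof. by move=> /W_gt0 w0; rewrite divr_ge0 ?exprn_ge0// ltW. Qed.

Lemma lam_gt0 n j : (0 < n)%N -> 0 < lam R n j.
Proof.
by move=> /W_gt0 w0; rewrite divr_gt0 ?exprn_gt0// ltr0n fact_gt0.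
Qed.

Lemma cvg_W : W R n @[n --> \oo] --> +oo.
Proof.
apply/cvgryPge => A; near=> n.
have n0 : (0 < n)%N by near: n; exists 1%N.
have [w0 wE] := W_spec R n0.
rewrite leNgt; apply/negP => wA.
have : n%:R < A * expR A.
  by rewrite -wE ltr_pM ?expR_ge0 ?ltr_expR// ltW.
by apply/negP; rewrite -leNgt; near: n; exact: nbhs_infty_ger.
Unshelve. all: by end_near. Qed.

Lemma dW_bounds n : (0 < n)%N -> (dW R n)%:R <= W R n < (dW R n)%:R + 1.
Proof.
by move=> n0; have [-> ->] := truncn_bounds (ltW (W_gt0 n0)).
Qed.

(** A crude Stirling bound. The inductive step is [e k^(k+1) <= (k+1)^(k+1)], a power of
    [1 - x <= e^-x] at [x = 1/(k+1)]. *)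
Lemma fact_le_expR d : (0 < d)%N ->
  d`!%:R <= d%:R ^+ d.+1 * expR (1 - d%:R) :> R.
Proof.
case: d => // d _; elim: d => [|d IH].
  by rewrite factS fact0 muln1 subrr expR0 expr1n mulr1.
have d0 : 0 < d.+1%:R :> R by rewrite ltr0n.
have d1 : 0 < d.+2%:R :> R by rewrite ltr0n.
have dS : d.+2%:R = d.+1%:R + 1 :> R by rewrite -natr1.
have key : d.+1%:R ^+ d.+2 * expR 1 <= d.+2%:R ^+ d.+2 :> R.
  have : d.+1%:R <= d.+2%:R * expR (- d.+2%:R^-1) :> R.
    rewrite -ler_pdivrMl//; apply: le_trans (expR_ge1Dx _).
    by rewrite dS; rewrite le_eqVlt; apply/orP; left; apply/eqP; field; lra.
  move=> /(lerXn2r d.+2); rewrite !nnegrE mulr_ge0 ?expR_ge0//.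
  move=> /(_ (ltW d0) isT); rewrite exprMn -expRM_natl mulrN divff ?gt_eqF//.
  by rewrite expRN ler_pdivlMr ?expR_gt0.
rewrite factS natrM exprS -mulrA ler_pM2l//; apply: (le_trans IH).
have -> : 1 - d.+1%:R = 1 + (1 - d.+2%:R) :> R by rewrite dS; ring.
by rewrite expRD mulrA ler_pM2r ?expR_gt0.
Qed.

Lemma expR2_le16 : expR 2 <= 16 :> R.
Proof.
have -> : 2 = 4%:R * 2^-1 :> R by lra.
rewrite expRM_natl.
have h : expR (2^-1) <= 2 :> R.
  by have := @expR_le_quadratic R 2^-1 (lexx _); lra.
have -> : 16 = 2 ^+ 4 :> R by ring.
by rewrite lerXn2r ?nnegrE ?expR_ge0.
Qed.

(** Since [d <= W < d + 1], the factorial bound gives [e^W d! <= e^2 W^(d+1)]; multiply by [W], use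
    [n = W e^W] and [e^2 <= 16]. *)
Lemma RW_lower n : (0 < n)%N -> 1 <= W R n ->
  n%:R <= 16 * W R n ^+ 2 * RW R n.
Proof.
move=> n0 w1; have [w0 wE] := W_spec R n0.
have /andP[dw wd] := dW_bounds n0.
rewrite /RW /lam; set d := dW R n in dw wd *.
set w := W R n in w0 wE w1 dw wd *.
have d0 : (0 < d)%N.
  by rewrite -(ltr_nat R); lra.
have d0' : 0 < d%:R :> R by rewrite ltr0n.
rewrite -wE expr2.
have shuffle (q : R) : 16 * (w * w) * q = w * (16 * w * q) by ring.
rewrite shuffle ler_pM2l// mulrA ler_pdivlMr ?ltr0n ?fact_gt0//.
apply: (le_trans (ler_wpM2l (expR_ge0 _) (fact_le_expR d0))).
rewrite mulrCA mulrC -expRD -mulrA -exprS; apply: ler_pM.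
- exact: expR_ge0.
- by rewrite exprn_ge0// ltW.
- by apply: le_trans expR2_le16; rewrite ler_expR; lra.
- by rewrite lerXn2r// nnegrE ltW.
Qed.

Lemma lamS n j : lam R n j.+1 = lam R n j * (W R n / j.+1%:R).
Proof.
rewrite /lam exprS factS natrM invfM.
by rewrite [RHS]mulrACA [W R n * _]mulrC [j.+1%:R^-1 * _]mulrC.
Qed.

(** The ratio [W / (j + 1)] of consecutive terms is at least 1 while [j + 1 <= d], and at most 1
    from [j = d] on: the mode is at [d]. *)
Lemma lam_homo n j k : (0 < n)%N -> (j <= k)%N -> (k <= dW R n)%N ->
  lam R n j <= lam R n k.
Proof.
move=> n0; elim: k => [|k IH]; first by rewrite leqn0 => /eqP ->.
rewrite leq_eqVlt => /predU1P[->//|jk] kd.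
apply: (le_trans (IH jk (ltnW kd))); rewrite lamS ler_peMr ?lam_ge0//.
rewrite ler_pdivlMr ?ltr0n// mul1r.
by have /andP[+ _] := dW_bounds n0; apply: le_trans; rewrite ler_nat.
Qed.

Lemma lam_nhomo n j k : (0 < n)%N -> (dW R n <= j)%N -> (j <= k)%N ->
  lam R n k <= lam R n j.
Proof.
move=> n0 dj; elim: k => [|k IH]; first by rewrite leqn0 => /eqP ->.
rewrite leq_eqVlt => /predU1P[->//|jk].
apply: le_trans (IH jk); rewrite lamS ler_piMr ?lam_ge0//.
rewrite ler_pdivrMr ?ltr0n// mul1r.
have /andP[_ /ltW /le_trans] := dW_bounds n0; apply.
by rewrite natr1 ler_nat ltnS (leq_trans dj).
Qed.

(** Monotonicity reduces to [j = d - 2] and [j = d + 2], where the ratios to [R_n] are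
    [d (d - 1) / W^2] and [W^2 / ((d + 1)(d + 2))]; then use [d <= W < d + 1]. *)
Lemma lam_gap n j : (0 < n)%N -> (1 < dW R n)%N ->
  j \notin [:: (dW R n).-1; dW R n; (dW R n).+1] ->
  lam R n j <= RW R n * (1 - ((dW R n)%:R + 2)^-1).
Proof.
move=> n0; rewrite /RW; have /andP[] := dW_bounds n0; have := W_gt0 n0.
case: (dW R n) (@lam_homo n j) (@lam_nhomo n) => [|[|d]]// up down w0 dw wd _.
rewrite !inE/= !negb_or => /and3P[j1 j2 j3].
have [jd|jd] := leqP j d.
  apply: (le_trans (up d n0 jd (leq_trans (leqnSn _) (leqnSn _)))).
  have d1 : 0 < d.+1%:R :> R by rewrite ltr0n.
  have d2 : 0 < d.+2%:R :> R by rewrite ltr0n.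
  have dS : d.+2%:R = d.+1%:R + 1 :> R by rewrite -natr1.
  rewrite !lamS -2!mulrA; apply: ler_peMr; first exact: lam_ge0.
  have : 1 <= W R n / d.+2%:R by rewrite ler_pdivlMr// mul1r.
  have -> : 1 - (d.+2%:R + 2)^-1 = (d.+2%:R + 1) / (d.+2%:R + 2) :> R.
    by field; lra.
  move=> w2; have : d.+2%:R / d.+1%:R <= W R n / d.+1%:R.
    by rewrite ler_pM2r ?invr_gt0.
  move=> w3; have : d.+2%:R / d.+1%:R * ((d.+2%:R + 1) / (d.+2%:R + 2))
    <= W R n / d.+1%:R * (W R n / d.+2%:R * ((d.+2%:R + 1) / (d.+2%:R + 2))).
    apply: ler_pM => //; rewrite ?divr_ge0//; try lra.
    by rewrite ler_peMl// divr_ge0//; lra.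
  by apply: le_trans; rewrite mulf_div ler_pdivlMr ?mulr_gt0//; lra.
have {}jd : (d.+4 <= j)%N.
  rewrite ltn_neqAle eq_sym j3/= ltn_neqAle eq_sym j2/= ltn_neqAle.
  by rewrite eq_sym j1.
apply: (le_trans (down d.+4 j n0 (leq_trans (leqnSn _) (leqnSn _)) jd)).
have d4 : 0 < d.+4%:R :> R by rewrite ltr0n.
have d3 : 0 < d.+3%:R :> R by rewrite ltr0n.
have wd3 : W R n <= d.+3%:R by rewrite -natr1 ltW.
have d4E : d.+4%:R = d.+3%:R + 1 :> R by rewrite -natr1.
have d3E : d.+3%:R = d.+2%:R + 1 :> R by rewrite -natr1.
rewrite lamS lamS -mulrA; apply: ler_wpM2l; first exact: lam_ge0.
have -> : 1 - (d.+2%:R + 2)^-1 = d.+3%:R / d.+4%:R :> R.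
  by rewrite d4E d3E; field; lra.
have w1 : W R n / d.+3%:R <= 1 by rewrite ler_pdivrMr// mul1r.
apply: (@le_trans _ _ (W R n / d.+4%:R)).
  by rewrite ler_piMl// divr_ge0// ltW.
by rewrite ler_pM2r ?invr_gt0.
Qed.

(** [RW_lower] gives [R_n >= e^W / (16 W)], and [e^W >= W^2 / 2] makes this at least [W / 32]. *)
Lemma cvg_RW : RW R n @[n --> \oo] --> +oo.
Proof.
apply/cvgryPge => A; near=> n.
have n0 : (0 < n)%N by near: n; exists 1%N.
have w1 : 32 * `|A| + 1 <= W R n.
  by near: n; move/cvgryPge : cvg_W; exact.
have A0 := normr_ge0 A.
have w1' : 1 <= W R n by lra.
have := RW_lower n0 w1'; have [w0 <-] := W_spec R n0.
have e2 : 1 + W R n ^+ 2 / 2 <= expR (W R n).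
  exact: (@expR_ge1Dxn R (W R n) 1 (ltW w0)).
have shuffle (q : R) : 16 * W R n ^+ 2 * q = W R n * (16 * W R n * q) by ring.
rewrite shuffle ler_pM2l// => lo.
apply: (le_trans (ler_norm A)).
have w16 : 0 < 16 * W R n by lra.
rewrite -(ler_pM2l w16); apply: le_trans lo; nra.
Unshelve. all: by end_near. Qed.

Lemma ln_bounds n : (0 < n)%N -> 1 <= W R n ->
  W R n <= ln n%:R <= 2 * W R n.
Proof.
move=> n0 w1; have [w0 <-] := W_spec R n0.
rewrite lnM ?posrE ?expR_gt0// expRK.
have := ln_ge0 w1; have := ln_sublinear w0; by lra.
Qed.

(* [R_n t^2] is at least of order [n / W^4] and [ln n >= W], hence the room left
   by the exponent 6 of the logarithm. *)
Lemma tail_negligible (K eps : R) : 0 < eps ->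
  \forall n \near \oo,
    n%:R * expR (K - RW R n * (4 * ((dW R n)%:R + 2))^-1 ^+ 2)
      <= eps * expR (- (n%:R / ln n%:R ^+ 6)).
Proof.
pose L : R := 32 * 64.
(* [t >= 1/(8 w)] and [r >= v/(16 w^2)] give [r t^2 >= v/(1024 w^4)]. As [L = 2048], this is two
   equal shares: one absorbs [n / ln^6 n], the other [ln n + K - ln eps]. *)
have A1 (r v w d : R) : 0 <= r -> v <= 16 * w ^+ 2 * r -> 0 <= d -> d <= w ->
    2 <= w -> 2 * (v / (L * w ^+ 4)) <= r * (4 * (d + 2))^-1 ^+ 2.
  move=> r0 vr d0 dw w2.
  have t2 : (8 * w)^-1 ^+ 2 <= (4 * (d + 2))^-1 ^+ 2.
    by rewrite lerXn2r ?nnegrE ?invr_ge0 ?lef_pV2 ?posrE//; lra.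
  apply: le_trans (ler_wpM2l r0 t2).
  have -> : r * (8 * w)^-1 ^+ 2 = 2 * (16 * w ^+ 2 * r / (L * w ^+ 4)).
    by rewrite /L; field; lra.
  by rewrite !ler_pM2l// ler_pM2r// invr_gt0 !mulr_gt0 ?exprn_gt0//; lra.
have A2 (v w l : R) : 0 < v -> 64 <= w -> w <= l ->
    v / l ^+ 6 <= v / (L * w ^+ 4).
  move=> v0 w64 wl; have w0 : 0 < w by lra.
  have l0 : 0 < l by lra.
  rewrite ler_pM2l// lef_pV2 ?posrE ?mulr_gt0 ?exprn_gt0//.
  apply: (@le_trans _ _ (w ^+ 6)).
    rewrite (exprD w 2 4) ler_pM2r ?exprn_gt0// expr2 ler_pM//; lra.
  by rewrite lerXn2r// nnegrE ltW.
(* The first premise comes from [n = W e^W] and the Taylor term [W^5 / 5!] of [e^W]: one power of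
   [W] more than is spent. *)
have A3 (v w k : R) : w * (w ^+ 5 / 120) <= v -> 64 <= w ->
    L * 120 * (2 + `|k|) <= w -> 2 * w + k <= v / (L * w ^+ 4).
  move=> wv w64 wk; have w0 : 0 < w by lra.
  have L0 : 0 < L by rewrite !mulr_gt0.
  have Lw : 0 < L * w ^+ 4 by rewrite mulr_gt0 ?exprn_gt0.
  apply: (@le_trans _ _ (w * ((2 + `|k|)))).
    have := ler_norm k; have := normr_ge0 k; nra.
  rewrite ler_pdivlMr//; apply: le_trans wv.
  have -> : w * (2 + `|k|) * (L * w ^+ 4)
      = w ^+ 5 / 120 * (L * 120 * (2 + `|k|)).
    by rewrite mulrCA; field.
  by rewrite mulrC ler_wpM2r// divr_ge0// exprn_ge0// ltW.
move: A1 A2 A3; have : 0 < L by rewrite !mulr_gt0.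
move: L => L L0 A1 A2 A3 eps0; near=> n.
have n0 : (0 < n)%N by near: n; exists 1%N.
have wL : L * 120 * (2 + `|K - ln eps|) <= W R n.
  by near: n; move/cvgryPge : cvg_W; exact.
have w64 : 64 <= W R n by near: n; move/cvgryPge : cvg_W; exact.
have w1 : 1 <= W R n by lra.
have w2 : 2 <= W R n by lra.
have [w0 wE] := W_spec R n0.
have /andP[dw _] := dW_bounds n0.
have /andP[l1 l2] := ln_bounds n0 w1.
have n0' : 0 < n%:R :> R by rewrite ltr0n.
have e5 : W R n ^+ 5 / 120 <= expR (W R n).
  have := @expR_ge1Dxn R (W R n) 4 (ltW w0); rewrite (_ : 5`! = 120%N)//.
  by apply: le_trans; rewrite lerDr.
have {}A1 := A1 _ _ _ _ (lam_ge0 _ n0) (RW_lower n0 w1) (ler0n R _) dw w2.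
have {}A2 := A2 _ _ _ n0' w64 l1.
have {}A3 : 2 * W R n + (K - ln eps) <= n%:R / (L * W R n ^+ 4).
  by apply: A3 => //; rewrite -wE ler_pM2l.
have -> : n%:R * expR (K - RW R n * (4 * ((dW R n)%:R + 2))^-1 ^+ 2)
    = expR (ln n%:R + (K - RW R n * (4 * ((dW R n)%:R + 2))^-1 ^+ 2)).
  by rewrite [RHS]expRD lnK.
have -> : eps * expR (- (n%:R / ln n%:R ^+ 6))
    = expR (ln eps - n%:R / ln n%:R ^+ 6).
  by rewrite [RHS]expRD lnK.
rewrite ler_expR.
move: A1 A2 A3 l2; rewrite -/(RW R n) => A1 A2 A3 l2; clear -A1 A2 A3 l2.
move: (n%:R / (L * _)) A1 A2 A3 => X A1 A2 A3; lra.
Unshelve. all: by end_near. Qed.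

End lambert_asymptotics.

(** * The maximum of independent Poisson variables *)

Section probability_of_maximum.
Context d (T : measurableType d) (R : realType) (P : probability T R).
Implicit Types (X : {RV P >-> nat}) (V : nat -> {RV P >-> nat}) (x r K : R).
Local Open Scope ereal_scope.

Let atmost x : set nat := [set k | (k%:R <= x)%R].

Let measurable_atmost X x : measurable (X @^-1` atmost x).
Proof. exact: measurable_funPTI. Qed.

Lemma EFin_prob_le X x : (prob_le X x)%:E = P (X @^-1` atmost x).
Proof.
rewrite /prob_le fineK//; apply: fin_num_measure.
exact: (measurable_atmost X x).
Qed.

Lemma prob_le_itv X x : (0 <= prob_le X x <= 1)%R.
Proof.
by rewrite -!lee_fin EFin_prob_le measure_ge0 probability_le1.
Qed.

(** The sign of [x] matters: [truncn] sends a negative number to 0, while the event is then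
    empty. *)
Lemma prob_le_poisson X r x : poisson_distributed X r -> (0 < r)%R ->
  (0 <= x)%R -> prob_le X x = pcdf (Num.truncn x) r.
Proof.
move=> Xr r0 x0; apply: EFin_inj; rewrite EFin_prob_le.
have -> : P (X @^-1` atmost x) = distribution P X (atmost x) by [].
rewrite Xr /poisson_prob r0.
have -> : atmost x = `I_(Num.truncn x).+1.
  by apply/seteqP; split=> k /=; rewrite /atmost/= ltnS truncn_ge_nat.
rewrite esum_fset//; last by move=> k _; rewrite lee_fin poisson_pmf_ge0.
rewrite -fsbig_ord sumEFin /pcdf /series/= big_mkord mulr_suml.
by congr EFin; apply: eq_bigr => k _; rewrite /poisson_pmf r0.
Qed.

Lemma Vmax_le V x w :
  (Vmax V w <= x%:E) <-> (forall j, (1 <= j)%N -> (((V j w)%:R : R) <= x)%R).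
Proof.
split=> [Vx j j1|Vx].
  rewrite -lee_fin; apply: le_trans Vx.
  by apply: ereal_sup_ubound; exists j.
by apply: ge_ereal_sup => _ [j j1 <-]; rewrite lee_fin Vx.
Qed.

(** The event for the maximum is contained in the event for the finite set [s], whose probability is
    a product by independence; a union bound over the other indices controls the difference. *)
Lemma prob_Vmax_le V x K (s : seq nat) (b : nat -> R) :
  mutually_independent [set j | (1 <= j)%N] V ->
  uniq s -> {in s, forall j, (1 <= j)%N} ->
  (forall j, (1 <= j)%N -> j \notin s -> 1 - prob_le (V j) x <= b j)%R ->
  (forall j, 0 <= b j)%R -> (forall N, series b N <= K)%R ->
  (`|fine (P [set w | (Vmax V w <= x%:E)%E]) - \prod_(j <- s) prob_le (V j) x|
    <= K)%R.
Proof.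
move=> indV us s1 tail b0 bK.
pose E j := V j @^-1` atmost x.
have mE j : measurable (E j) by exact: measurable_atmost.
have -> : [set w | Vmax V w <= x%:E] = \bigcap_(j in [set j | (1 <= j)%N]) E j.
  by apply/seteqP; split=> w /=; rewrite Vmax_le.
set M := \bigcap_(j in _) _.
have mM : measurable M by exact: bigcap_measurableType.
pose J := [fset j in s]%fset.
pose F := \bigcap_(j in [set` J]) E j.
have mF : measurable F by exact: bigcap_measurableType.
have PF : P F = (\prod_(j <- s) prob_le (V j) x)%:E.
  rewrite (indV J (fun=> atmost x))//; last first.
    by move=> j /=; rewrite inE/=; exact: s1.
  rewrite -prodEFin (perm_big s)/=.
    by apply: eq_bigr => j _; rewrite EFin_prob_le.
  by apply: uniq_perm => [|//|j]; [exact: fset_uniq|rewrite inE].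
have MF : M `<=` F.
  by move=> w Mw j /=; rewrite inE/= => /s1; exact: Mw.
have PFM : P (F `\` M) <= K%:E.
  (* Empty at 0 and on [s], so that the union may run over all naturals. *)
  pose B j := if (1 <= j)%N && (j \notin s) then ~` E j else set0.
  have mB j : measurable (B j).
    by rewrite /B; case: ifP => // _; exact: measurableC.
  have sub : F `\` M `<=` \bigcup_j B j.
    move=> w [Fw /existsNP[j]]; rewrite not_implyE => -[j1 Ejw].
    exists j => //; rewrite /B j1/=; case: ifPn => //.
    by rewrite negbK => js; case: Ejw; apply: Fw; rewrite /= inE.
  apply: (le_trans (measure_sigma_subadditive P mB (measurableD mF mM) sub)).
  apply: lime_le; first by apply: is_cvg_nneseries => *; exact: measure_ge0.
  apply: nearW => N; apply: (@le_trans _ _ (series b N)%:E); last first.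
    by rewrite lee_fin.
  rewrite /series/= -sumEFin; apply: lee_sum => j _.
  rewrite /B; case: ifP => [/andP[j1 js]|_].
    rewrite probability_setC// -EFin_prob_le -EFinB lee_fin.
    exact: tail.
  by rewrite measure0 lee_fin.
have PFMK : P F - P M <= K%:E.
  have := measureD mF mM (_ : P F < +oo).
  rewrite (setIidr MF) => <-; first exact: PFM.
  by rewrite PF ltry.
have fPM : P M = (fine (P M))%:E by rewrite fineK// fin_num_measure.
have PMF : P M <= P F by rewrite le_measure ?inE.
move: PFMK PMF; rewrite PF fPM -EFinB !lee_fin => ? ?.
by rewrite distrC ger0_norm// subr_ge0.
Qed.

End probability_of_maximum.

(** * Chernoff bound for parameters separated from the largest one *)

Section poisson_tail.
Variable R : realType.
Implicit Types (r l c t : R).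

(** [pcdf_tailS] yields the factor [l], then Chernoff the exponent
    [c sqrt r t + 2 t - 2 r t^2 - 8 r t^3]; one [r t^2] pays for [c sqrt r t <= c^2 + r t^2]. *)
Lemma poisson_tail_gap r l c t : 0 <= r ->
  0 < t -> t <= 2^-1 -> 0 <= l -> l <= r * (1 - 4 * t) ->
  1 <= r - c * Num.sqrt r ->
  1 - pcdf (Num.truncn (r - c * Num.sqrt r)) l
    <= l * expR (c ^+ 2 + 1 - r * t ^+ 2).
Proof.
move=> r0 t0 t2 l0 lr x1.
have [_] := truncn_bounds (le_trans ler01 x1).
have : (0 < Num.truncn (r - c * Num.sqrt r))%N by rewrite truncn_gt0.
case: (Num.truncn _) => // m _ mx.
apply: (le_trans (pcdf_tailS m l0)); rewrite ler_wpM2l//.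
apply: (le_trans (pcdf_chernoff_ge m l0 (ltW t0))); rewrite ler_expR.
have st : c * Num.sqrt r * t <= c ^+ 2 + r * t ^+ 2.
  rewrite -[in X in _ <= X](sqr_sqrtr r0).
  set s := Num.sqrt r.
  have := sqr_ge0 (c - s * t); have := sqr_ge0 c.
  have := sqr_ge0 (s * t); rewrite !expr2; nra.
have h1 : l * (expR t - 1) <= r * (1 - 4 * t) * (t + 2 * t ^+ 2).
  have e0 : 0 <= expR t - 1 by rewrite subr_ge0 expR_ge1 ltW.
  apply: ler_pM => //; have := expR_le_quadratic t2; lra.
(* The loss of 2 is one unit for truncation and one for the shift by [pcdf_tailS]. *)
have h2 : t * (r - c * Num.sqrt r - 2) <= t * m%:R.
  by rewrite ler_pM2l//; move: mx; rewrite -natr1; lra.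
have h3 : 0 <= r * t ^+ 3 by rewrite mulr_ge0// exprn_ge0// ltW.
apply: (le_trans (lerB h1 h2)).
have -> : r * (1 - 4 * t) * (t + 2 * t ^+ 2) - t * (r - c * Num.sqrt r - 2)
  = c * Num.sqrt r * t + 2 * t - 2 * (r * t ^+ 2) - 8 * (r * t ^+ 3) by ring.
lra.
Qed.

End poisson_tail.

(** * Reduction to three indices, and the limit at the central one *)

Section poisson_maximum.
Context (R : realType) (disp : nat -> measure_display)
  (T : forall n : nat, measurableType (disp n))
  (P : forall n : nat, probability (T n) R)
  (V : forall n : nat, nat -> {RV (P n) >-> nat})
  (V_poisson : forall n j : nat, (1 <= n)%N -> (1 <= j)%N ->
     poisson_distributed (V n j) (lam R n j))
  (V_indep : forall n : nat, (1 <= n)%N ->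
     mutually_independent [set j : nat | (1 <= j)%N] (V n))
  (c : R).

Let x n := RW R n - c * Num.sqrt (RW R n).

(** With [t = 1/(4 (d + 2))] the factor [1 - 4 t] of the tail bound is exactly the gap factor of
    [lam_gap]. *)
Lemma prob_Vmax_approx n : (0 < n)%N -> 2 <= W R n -> 1 <= x n ->
  `| fine (P n [set w | (Vmax (V n) w <= (x n)%:E)%E])
     - \prod_(j <- [:: (dW R n).-1; dW R n; (dW R n).+1])
         prob_le (V n j) (x n) |
  <= n%:R * expR (c ^+ 2 + 1 - RW R n * (4 * ((dW R n)%:R + 2))^-1 ^+ 2).
Proof.
move=> n0 w2 x1; have [w0 wE] := W_spec R n0.
have /andP[dw wd] := dW_bounds R n0.
have d2 : (1 < dW R n)%N.
  by move: wd; rewrite natr1 => /(le_lt_trans w2); rewrite ltr_nat ltnS.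
set C := expR _.
apply: (@prob_Vmax_le _ _ _ _ _ _ _ _ (fun j => lam R n j * C)).
- exact: V_indep.
- case: (dW R n) d2 => [|[|d]]//= _; rewrite !inE !negb_or.
  by rewrite !ltn_eqF// ltnS leqnSn.
- by move=> j; rewrite !inE => /or3P[] /eqP->; case: (dW R n) d2 => [|[|]].
- move=> j j1 js; rewrite (prob_le_poisson (V_poisson n0 j1) (lam_gt0 R j n0)).
    apply: poisson_tail_gap.
    + exact: lam_ge0.
    + by rewrite invr_gt0 mulr_gt0// ltr_wpDl.
    + by rewrite lef_pV2 ?posrE//; have := ler0n R (dW R n); lra.
    + exact: lam_ge0.
    + apply: (le_trans (lam_gap n0 d2 js)).
      by rewrite invfM mulrA divff// mul1r.
    + exact: x1.
  exact: le_trans x1.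
- by move=> j; rewrite mulr_ge0 ?expR_ge0 ?lam_ge0.
- move=> N; rewrite /series/= -mulr_suml ler_wpM2r ?expR_ge0//.
  (* The [lam R n j] are the terms of the series of [e^W], and [e^W <= W e^W = n]. *)
  apply: (le_trans (series_exp_coeff_le N (ltW w0))).
  by rewrite -wE ler_peMl ?expR_ge0//; lra.
Qed.

(** With [s = sqrt R_n] the threshold is [s (s - c)], at least 1 once [s >= |c| + 1]. *)
Lemma near_threshold : \forall n \near \oo, 1 <= x n.
Proof.
move/cvgryPge : (@cvg_RW R) => /(_ ((`|c| + 1) ^+ 2)).
apply: filterS => n Rn; rewrite /x.
have c0 := normr_ge0 c; have c1 := ler_norm c.
have R0 : 0 <= RW R n by apply: le_trans Rn; exact: sqr_ge0.
have : `|c| + 1 <= Num.sqrt (RW R n).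
  by rewrite -[leLHS]ger0_norm ?addr_ge0// -sqrtr_sqr ler_wsqrtr.
by rewrite -[X in X - _](sqr_sqrtr R0) expr2; nra.
Qed.

Lemma cvg_prob_le_dW : prob_le (V n (dW R n)) (x n) @[n --> \oo] --> Phi (- c).
Proof.
have := @poisson_clt R (RW R) c (@cvg_RW R); apply: cvg_trans.
apply: near_eq_cvg.
near=> n; have n0 : (0 < n)%N by near: n; exists 1%N.
have w1 : 1 <= W R n by near: n; move/cvgryPge : (@cvg_W R); exact.
have d1 : (0 < dW R n)%N by rewrite truncn_gt0.
rewrite (prob_le_poisson (V_poisson n0 d1) (lam_gt0 R _ n0))//.
by apply: (@le_trans _ _ 1) => //; near: n; exact: near_threshold.
Unshelve. all: by end_near. Qed.

End poisson_maximum.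

Theorem theorem2 (R : realType)
    (disp : nat -> measure_display)
    (T : forall n : nat, measurableType (disp n))
    (P : forall n : nat, probability (T n) R)
    (V : forall n : nat, nat -> {RV (P n) >-> nat})
    (V_poisson : forall n j : nat, (1 <= n)%N -> (1 <= j)%N ->
       poisson_distributed (V n j) (lam R n j))
    (V_indep : forall n : nat, (1 <= n)%N ->
       mutually_independent [set j : nat | (1 <= j)%N] (V n))
    (c : R) :
  let x n := RW R n - c * Num.sqrt (RW R n) in
  (fun n : nat =>
     `| fine (P n [set w | (Vmax (V n) w <= (x n)%:E)%E])
        - \prod_(j <- [:: (dW R n).-1; dW R n; (dW R n).+1])
            prob_le (V n j) (x n) | : R)
    =o_\oo (fun n : nat => expR (- (n%:R / ln n%:R ^+ 6)) : R)
  /\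
  (fun n : nat =>
     \prod_((dW R n).-1 <= j < (dW R n).+2) prob_le (V n j) (x n) : R)
    = (fun n : nat =>
     Phi (- c) * \prod_(j <- [:: (dW R n).-1; (dW R n).+1])
                   prob_le (V n j) (x n) : R)
    +o_\oo (fun _ : nat => 1 : R).
Proof.
move=> x; split.
  apply/eqoP => eps eps0; near=> n.
  have n0 : (0 < n)%N by near: n; exists 1%N.
  have w2 : 2 <= W R n by near: n; move/cvgryPge : (@cvg_W R); exact.
  have x1 : 1 <= x n by near: n; exact: near_threshold.
  rewrite normr_id (gtr0_norm (expR_gt0 _)).
  apply: (le_trans (prob_Vmax_approx V_poisson V_indep n0 w2 x1)).
  by near: n; exact: tail_negligible.
apply/eqaddoP => eps eps0.
have /cvgrPdist_le /(_ _ eps0) cp := cvg_prob_le_dW V_poisson (c := c).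
near=> n.
have w1 : 1 <= W R n by near: n; move/cvgryPge : (@cvg_W R); exact.
have d1 : (0 < dW R n)%N by rewrite truncn_gt0.
rewrite !fctE normr1 mulr1.
have -> : \prod_((dW R n).-1 <= j < (dW R n).+2) prob_le (V n j) (x n)
    = prob_le (V n (dW R n)) (x n)
      * \prod_(j <- [:: (dW R n).-1; (dW R n).+1]) prob_le (V n j) (x n).
  rewrite big_ltn ?prednK ?leqW// big_ltn; last by rewrite leqW.
  by rewrite big_nat1 !big_cons big_nil mulr1 mulrCA.
rewrite -mulrBl normrM distrC.
set q := \prod_(j <- _) _.
(* The two outer factors need no limit: their product lies in [[0, 1]] and does not amplify the
   error of the central one. *)
have /andP[q0 q1] : 0 <= q <= 1.
  rewrite /q !big_cons big_nil mulr1.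
  have /andP[? ?] := prob_le_itv (V n (dW R n).-1) (x n).
  have /andP[? ?] := prob_le_itv (V n (dW R n).+1) (x n).
  by rewrite mulr_ge0//= mulr_ile1.
rewrite (ger0_norm q0) -[leRHS]mulr1 ler_pM//.
by near: n; exact: cp.
Unshelve. all: by end_near. Qed.
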